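(* Let $R=\mathbb{Z}\oplus\bigoplus_{i\ge 1}\mathbb{Z}/2\mathbb{Z}$ be the commutative ring with componentwise addition and multiplication $(m,a)\cdot(n,b)=(mn,\,mb+na+ab)$. Then $R$ is a $2$-coherent ring.
   Context: In the multiplication, $m,n\in\mathbb{Z}$, $a,b\in\bigoplus_{i\ge1}\mathbb{Z}/2\mathbb{Z}$, $ma=(ma_1,ma_2,\dots)$ and $ab=(a_1b_1,a_2b_2,\dots)$. For an integer $n\ge 0$, $\mathcal{FP}_n$ is the class of $R$-modules $F$ admitting an exact sequence $F_n\to F_{n-1}\to\cdots\to F_0\to F\to 0$ with each $F_i$ finitely generated and free (equivalently projective). $R$ is $n$-coherent if $\mathcal{FP}_n\subseteq\mathcal{FP}_{n+1}$. *)

(* Defs.v *)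
From HB Require Import structures.
From mathcomp Require Import all_boot all_order all_algebra finmap.

Set Implicit Arguments.
Unset Strict Implicit.
Unset Printing Implicit Defensive.

Import GRing.Theory.

Local Open Scope fset_scope.
Local Open Scope ring_scope.

Section Coherence.
Variable R : nzRingType.

Definition fg_free (M : lmodType R) : Prop :=
  exists (k : nat) (e : 'I_k -> M),
    forall x : M, exists! c : {ffun 'I_k -> R}, x = \sum_i c i *: e i.

Definition exact_at (U V W : Type) (z : W) (f : U -> V) (g : V -> W) : Prop :=
  forall v, g v = z <-> exists u, f u = v.

(* Only the part of (P, d) in degrees <= n is constrained; the modules P i with
   n < i are irrelevant (they may be taken to be 0).  There is no exactness
   condition at P n. *)
Definition FP (n : nat) (F : lmodType R) : Prop :=
  exists (P : nat -> lmodType R) (d : forall i, {linear P i.+1 -> P i})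
         (aug : {linear P 0%N -> F}),
    [/\ forall i, (i <= n)%N -> fg_free (P i),
        forall x : F, exists y, aug y = x,
        (0 < n)%N -> exact_at 0 (d 0%N) aug
      & forall i, (i.+1 < n)%N -> exact_at 0 (d i.+1) (d i)].

Definition coherent (n : nat) : Prop :=
  forall F : lmodType R, FP n F -> FP n.+1 F.

End Coherence.

(* Coordinates are numbered from 0 instead of 1. *)
Definition dsumZ2 := {fsfun nat -> 'Z_2 with 0}.

HB.instance Definition _ := Choice.on dsumZ2.

Definition ds_zero : dsumZ2 := [fsfun with 0].
Definition ds_opp (a : dsumZ2) : dsumZ2 :=
  [fsfun i in finsupp a => - a i].
Definition ds_add (a b : dsumZ2) : dsumZ2 :=
  [fsfun i in finsupp a `|` finsupp b => a i + b i].
Definition ds_mul (a b : dsumZ2) : dsumZ2 :=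
  [fsfun i in finsupp a `|` finsupp b => a i * b i].

Lemma ds_zeroE i : ds_zero i = 0.
Proof. by rewrite fsfunE. Qed.

Lemma ds_oppE a i : ds_opp a i = - a i.
Proof. by rewrite fsfunE; case: finsuppP; rewrite ?oppr0. Qed.

Lemma ds_addE a b i : ds_add a b i = a i + b i.
Proof.
by rewrite fsfunE inE; case: (finsuppP a); case: (finsuppP b); rewrite ?addr0.
Qed.

Lemma ds_mulE a b i : ds_mul a b i = a i * b i.
Proof.
by rewrite fsfunE inE; case: (finsuppP a); case: (finsuppP b); rewrite ?mulr0.
Qed.

Fact ds_addA : associative ds_add.
Proof. by move=> a b c; apply/fsfunP=> i; rewrite !ds_addE addrA. Qed.
Fact ds_addC : commutative ds_add.
Proof. by move=> a b; apply/fsfunP=> i; rewrite !ds_addE addrC. Qed.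
Fact ds_add0 : left_id ds_zero ds_add.
Proof. by move=> a; apply/fsfunP=> i; rewrite ds_addE ds_zeroE add0r. Qed.
Fact ds_addN : left_inverse ds_zero ds_opp ds_add.
Proof.
by move=> a; apply/fsfunP=> i; rewrite ds_addE ds_oppE ds_zeroE addNr.
Qed.

HB.instance Definition _ :=
  GRing.isZmodule.Build dsumZ2 ds_addA ds_addC ds_add0 ds_addN.

Fact ds_mulA : associative ds_mul.
Proof. by move=> a b c; apply/fsfunP=> i; rewrite !ds_mulE mulrA. Qed.
Fact ds_mulC : commutative ds_mul.
Proof. by move=> a b; apply/fsfunP=> i; rewrite !ds_mulE mulrC. Qed.
Fact ds_mulDl : left_distributive ds_mul +%R.
Proof.
by move=> a b c; apply/fsfunP=> i; rewrite !(ds_mulE, ds_addE) mulrDl.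
Qed.
Fact ds_mul0 (a : dsumZ2) : ds_mul 0 a = 0.
Proof. by apply/fsfunP=> i; rewrite ds_mulE ds_zeroE mul0r. Qed.

Fact ds_mulzl (m : int) (a b : dsumZ2) : ds_mul (a *~ m) b = ds_mul a b *~ m.
Proof.
have mulN x y : ds_mul (- x) y = - ds_mul x y.
  by apply/fsfunP=> i; rewrite !(ds_mulE, ds_oppE) mulNr.
have muln n : ds_mul (a *+ n) b = ds_mul a b *+ n.
  by elim: n => [|n IHn]; rewrite ?mulr0n ?ds_mul0 // !mulrS ds_mulDl IHn.
by case: m => n; rewrite ?NegzE ?mulrNz ?mulN -!pmulrn muln.
Qed.

Fact ds_mulzr (m : int) (a b : dsumZ2) : ds_mul a (b *~ m) = ds_mul a b *~ m.
Proof. by rewrite ds_mulC ds_mulzl ds_mulC. Qed.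

(* Z (+) (+)_i Z/2, with the additive group structure of the product. *)
Definition ZplusZ2 := (int * dsumZ2)%type.

HB.instance Definition _ := GRing.Zmodule.on ZplusZ2.

Definition zz_one : ZplusZ2 := (1, 0).
Definition zz_mul (x y : ZplusZ2) : ZplusZ2 :=
  (x.1 * y.1, y.2 *~ x.1 + x.2 *~ y.1 + ds_mul x.2 y.2).

Fact zz_mulC : commutative zz_mul.
Proof.
move=> [m a] [n b]; congr (_, _) => /=; first exact: mulrC.
by rewrite ds_mulC [_ *~ m + _]addrC.
Qed.

Fact zz_mulDl : left_distributive zz_mul +%R.
Proof.
move=> [m a] [n b] [p c]; congr (_, _) => /=; first exact: mulrDl.
by rewrite ds_mulDl mulrzDr mulrzDl [LHS](AC (2*2*2) (1*3*5*(2*4*6))).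
Qed.

Fact zz_mulA : associative zz_mul.
Proof.
move=> [m a] [n b] [p c]; congr (_, _) => /=; first exact: mulrA.
have mulDr u v w : ds_mul u (v + w) = ds_mul u v + ds_mul u w.
  by rewrite ds_mulC ds_mulDl !(ds_mulC u).
rewrite !(mulDr, ds_mulDl, ds_mulzl, ds_mulzr, mulrzDl, mulrzDr) ds_mulA.
rewrite -!mulrzA (mulrC n m) (mulrC p m).
by rewrite [LHS](AC (4*3) (1*(2*4*6)*(3*5*7))).
Qed.

Fact zz_mul1 : left_id zz_one zz_mul.
Proof.
by move=> [m a]; rewrite /zz_mul /= mul1r ds_mul0 mul0rz !addr0.
Qed.

Fact zz_oneN0 : zz_one != 0.
Proof. by []. Qed.

HB.instance Definition _ :=
  GRing.Zmodule_isComNzRing.Build ZplusZ2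
    zz_mulA zz_mulC zz_mul1 zz_mulDl zz_oneN0.

(* Main.v *)
(* The ring is the ring of pairs (m, t) in Z x prod_i Z/2 with t_i = m mod 2 for
   almost all i.  Given P_2 -> P_1 -> P_0 exact at P_1, write A for the matrix of
   P_1 -> P_0.  Outside of finitely many coordinates, A is an integer matrix; put
   it in Smith normal form.  An even nonzero elementary divisor would put
   infinitely many independent 2-torsion elements in the kernel of A, which is
   finitely generated, so all nonzero elementary divisors are odd.  Hence ker A
   is a direct summand of P_1 (at the finitely many other coordinates this is
   linear algebra over Z/2), so P_2 -> ker A splits and its kernel is finitely
   generated. *)
Require Import Defs.
From HB Require Import structures.
From mathcomp Require Import all_boot all_order all_algebra finmap.

Set Implicit Arguments.
Unset Strict Implicit.
Unset Printing Implicit Defensive.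

Import GRing.Theory.

Local Open Scope ring_scope.

(** * Linear combinations, bases and matrices of linear maps *)

Section LinearCombination.
Variables (R : nzRingType) (M : lmodType R) (k : nat).

Definition lincomb (e : 'I_k -> M) (c : 'rV[R]_k) : M := \sum_i c 0 i *: e i.

Fact lincomb_is_linear e : linear (lincomb e).
Proof.
move=> a u v; rewrite /lincomb scaler_sumr -big_split /=.
by apply: eq_bigr => i _; rewrite !mxE scalerDl scalerA.
Qed.

HB.instance Definition _ e :=
  GRing.isLinear.Build R 'rV[R]_k M *:%R (lincomb e) (lincomb_is_linear e).

End LinearCombination.

Section FreeModules.
Variable R : nzRingType.

Lemma lincomb_mulmx (M : lmodType R) k l (e : 'I_l -> M) (A : 'M[R]_(k, l)) c :
  lincomb e (c *m A) = lincomb (fun i => lincomb e (row i A)) c.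
Proof.
rewrite mulmx_sum_row linear_sum; apply: eq_bigr => i _; exact: linearZ.
Qed.

Lemma linear_lincomb (M N : lmodType R) (f : {linear M -> N}) k (e : 'I_k -> M) c :
  f (lincomb e c) = lincomb (f \o e) c.
Proof. by rewrite linear_sum; apply: eq_bigr => i _; exact: linearZ. Qed.

Lemma eq_lincomb (M : lmodType R) k (e e' : 'I_k -> M) :
  e =1 e' -> lincomb e =1 lincomb e'.
Proof. by move=> ee c; apply: eq_bigr => i _; rewrite ee. Qed.

(** Unique coordinates are recast as bijectivity of [lincomb e] on row vectors, on which linear maps
    act by matrices. *)
Lemma fg_free_basis (M : lmodType R) : fg_free M ->
  exists (k : nat) (e : 'I_k -> M),
    (forall x, exists c, x = lincomb e c) /\ injective (lincomb e).
Proof.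
move=> [k [e He]]; exists k, e; split=> [x|c c' cc'].
  have [c [-> _]] := He x; exists (\row_i c i).
  by apply: eq_bigr => i _; rewrite mxE.
have [c0 [_ U]] := He (lincomb e c).
have E b : lincomb e c = lincomb e b -> c0 = [ffun i => b 0 i].
  by move=> h; apply: U; rewrite h; apply: eq_bigr => i _; rewrite ffunE.
apply/rowP=> i; have := E c erefl; rewrite (E _ cc').
by move/ffunP/(_ i); rewrite !ffunE.
Qed.

Lemma fg_free_rV k : fg_free 'rV[R]_k.
Proof.
exists k, (fun i => delta_mx 0 i) => x; exists [ffun i => x 0 i]; split.
  by rewrite [LHS]row_sum_delta; apply: eq_bigr => i _; rewrite ffunE.
move=> c ->; apply/ffunP=> i; rewrite ffunE summxE (bigD1 i) //= big1 => [|j ji].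
  by rewrite !mxE !eqxx mulr1 addr0.
by rewrite !mxE (eq_sym i) (negPf ji) andbF mulr0.
Qed.

Lemma matrix_of_linear (M N : lmodType R) (f : {linear M -> N}) k l
    (e : 'I_k -> M) (e' : 'I_l -> N) :
    (forall y, exists c, y = lincomb e' c) ->
  exists A : 'M[R]_(k, l), forall c, f (lincomb e c) = lincomb e' (c *m A).
Proof.
move=> gen; have /fin_all_exists [r Hr] i := gen (f (e i)).
exists (\matrix_i r i) => c; rewrite lincomb_mulmx linear_lincomb.
by apply: eq_lincomb => i; rewrite rowK; exact: Hr.
Qed.

(** * Extending a resolution by one step *)

Definition fg_ker (U V : lmodType R) (f : U -> V) : Prop :=
  exists (k : nat) (g : 'I_k -> U), forall x, f x = 0 <-> exists c, lincomb g c = x.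

(** A free module on the generators of the kernel of [d 1%N] is placed in degree 3; above it the
    sequence continues with zero maps. *)
Lemma FP2_FP3 (P : nat -> lmodType R) (d : forall i, {linear P i.+1 -> P i})
    (F : lmodType R) (aug : {linear P 0%N -> F}) :
    (forall i, (i <= 2)%N -> fg_free (P i)) -> (forall x, exists y, aug y = x) ->
    exact_at 0 (d 0%N) aug -> exact_at 0 (d 1%N) (d 0%N) -> fg_ker (d 1%N) ->
  FP 3 F.
Proof.
move=> freeP surj ex0 ex1 [k [g Hg]].
pose Q i : lmodType R := match i with
  | 0 => P 0%N | 1 => P 1%N | 2 => P 2%N | _ => 'rV[R]_k end.
pose dQ i : {linear Q i.+1 -> Q i} := match i with
  | 0 => d 0%N | 1 => d 1%N | 2 => lincomb g
  | i'.+3 => \0 : {linear 'rV[R]_k -> 'rV[R]_k} end.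
exists Q, dQ, aug; split=> //.
  by case=> [|[|[|[|]]]] // _; try exact: freeP; exact: fg_free_rV.
by case=> [|[|]].
Qed.

(* E is the matrix of a projection of P1 onto the kernel of d0. *)
Lemma fg_ker_split (P0 P1 P2 : lmodType R) (d0 : {linear P1 -> P0})
    (d1 : {linear P2 -> P1}) :
    fg_free P0 -> fg_free P1 -> fg_free P2 -> exact_at 0 d1 d0 ->
    (forall (m n k : nat) (A : 'M[R]_(m, n)) (B : 'M[R]_(k, m)),
       (forall x : 'rV_m, x *m A = 0 <-> exists c, c *m B = x) ->
       exists E : 'M_m, E *m A = 0 /\ forall x : 'rV_m, x *m A = 0 -> x *m E = x) ->
  fg_ker d1.
Proof.
move=> /fg_free_basis[n [e0 [gen0 inj0]]] /fg_free_basis[m [e1 [gen1 inj1]]].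
move=> /fg_free_basis[k [e2 [gen2 inj2]]] ex split_ker.
have [A HA] := matrix_of_linear d0 e1 gen0.
have [B HB] := matrix_of_linear d1 e2 gen1.
have kerA (x : 'rV_m) : x *m A = 0 <-> d0 (lincomb e1 x) = 0.
  rewrite HA; split=> [->|]; first exact: linear0.
  by rewrite -[RHS](linear0 (lincomb e0)) => /inj0.
have exAB (x : 'rV_m) : x *m A = 0 <-> exists c, c *m B = x.
  split=> [/kerA/ex[u]|[c <-]].
    by have [c ->] := gen2 u; rewrite HB => /inj1; exists c.
  by apply/kerA/ex; exists (lincomb e2 c).
have [E [EA idE]] := split_ker _ _ _ _ _ exAB.
have BE (c : 'rV_k) : c *m B *m E = c *m B by apply: idE; apply/exAB; exists c.
(* The rows of [E] lie in the kernel of [A], which is the image of [d1]; [s j] lifts row [j]. *)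
have /fin_all_exists [s Hs] j : exists u, d1 u = lincomb e1 (row j E).
  by apply/ex/kerA; rewrite -row_mul EA row0.
have d1s c : d1 (lincomb s c) = lincomb e1 (c *m E).
  by rewrite linear_lincomb lincomb_mulmx; apply: eq_lincomb.
(* Subtracting from [x] the lift of [d1 x] through [s] projects [P2] onto the kernel of [d1]; [g]
   lists the values of this projection on the basis [e2]. *)
pose g i := e2 i - lincomb s (row i B).
have gE c : lincomb g c = lincomb e2 c - lincomb s (c *m B).
  rewrite lincomb_mulmx /lincomb -sumrB.
  by apply: eq_bigr => i _; rewrite scalerBr.
exists k, g => x; split=> [|[c <-]]; last first.
  by rewrite gE linearB /= d1s HB BE subrr.
have [c ->] := gen2 x; rewrite HB -[RHS](linear0 (lincomb e1)) => /inj1 cB.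
by exists c; rewrite gE cB linear0 subr0.
Qed.

End FreeModules.

(** * Kernels of integer matrices and of their reductions *)

(** The outer factors of the Smith form stay invertible under every morphism [f], so the kernel over
    [S] can be read off the diagonal. *)
Lemma smith_ker m n (A : 'M[int]_(m, n)) :
  exists (L L' : 'M[int]_m) (d : 'I_m -> int), [/\ L *m L' = 1%:M, L' *m L = 1%:M &
    forall (S : comNzRingType) (f : {rmorphism int -> S}) (y : 'rV[S]_m),
      y *m map_mx f A = 0 <-> forall j, (y *m map_mx f L) 0 j * f (d j) = 0].
Proof.
have [L uL [Q uQ [d _ AE]]] := int_Smith_normal_form A.
pose D : 'M_(m, n) := \matrix_(i, j) (d`_i *+ (i == j :> nat)).
(* Rows of the diagonal factor with index at least [n] vanish, hence the value 0 there. *)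
exists L, (invmx L), (fun j => if (j < n)%N then d`_j else 0).
split; [exact: mulmxV | exact: mulVmx | move=> S f y].
have AD : y *m map_mx f A = y *m map_mx f L *m map_mx f D *m map_mx f Q.
  by rewrite AE !map_mxM !mulmxA.
have -> : y *m map_mx f A = 0 <-> y *m map_mx f L *m map_mx f D = 0.
  rewrite AD; split=> [h|->]; last by rewrite mul0mx.
  have := congr1 (mulmx^~ (map_mx f (invmx Q))) h.
  by rewrite mul0mx -mulmxA -map_mxM mulmxV // map_mx1 mulmx1.
set z := y *m map_mx f L.
have zD (i : 'I_m) (j : 'I_n) : i = j :> nat -> (z *m map_mx f D) 0 j = z 0 i * f d`_i.
  move=> ij; rewrite mxE (bigD1 i) //= big1 => [|k ki].
    by rewrite !mxE ij eqxx mulr1n addr0.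
  have /negPf kj : (k != j :> nat) by rewrite -ij.
  by rewrite !mxE kj mulr0n rmorph0 mulr0.
split=> [z0 i|z0].
  case: ifP => [lin|_]; last by rewrite rmorph0 mulr0.
  by rewrite -(zD i (Ordinal lin)) // z0 mxE.
apply/rowP=> j; rewrite [RHS]mxE; have [ltjm|lemj] := ltnP j m.
  by rewrite (zD (Ordinal ltjm)) //; have := z0 (Ordinal ltjm); rewrite /= ltn_ord.
rewrite mxE big1 // => i _; have /negPf ij : (i != j :> nat).
  by rewrite neq_ltn (leq_trans (ltn_ord i) lemj).
by rewrite !mxE ij mulr0n rmorph0 mulr0.
Qed.

(* The second alternative comes from a nonzero elementary divisor that vanishes
   in F: the linear form w kills the kernel of A, but not the kernel of A over F. *)
Lemma smith_ker_reduction m n (A : 'M[int]_(m, n)) (F : fieldType) :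
  (exists E : 'M[int]_m, [/\ E *m A = 0,
     forall y : 'rV_m, y *m A = 0 -> y *m E = y &
     forall y : 'rV[F]_m, y *m map_mx intr A = 0 -> y *m map_mx intr E = y]) \/
  (exists (w : 'cV[int]_m) (y : 'rV[F]_m), [/\ y *m map_mx intr A = 0,
     y *m map_mx intr w != 0 & forall z : 'rV_m, z *m A = 0 -> z *m w = 0]).
Proof.
have [L [L' [d [LL' L'L kerA]]]] := smith_ker A.
have map_int_id p q (B : 'M[int]_(p, q)) : map_mx (idfun : int -> int) B = B.
  by apply/matrixP=> i j; rewrite mxE.
have kerAZ (y : 'rV_m) : y *m A = 0 <-> forall j, (y *m L) 0 j * d j = 0.
  by have := kerA _ (idfun : {rmorphism int -> int}) y; rewrite !map_int_id.
have := boolP [exists j, (d j != 0) && ((d j)%:~R == 0 :> F)].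
case=> [/existsP[j /andP[dj dj0]] | /existsPn odd_d]; [right | left].
  (* In the coordinates [y *m L], these are the [j]-th coordinate form and the [j]-th basis
     vector. *)
  exists (col j L), (row j (map_mx intr L')).
  have L'LF : map_mx intr L' *m map_mx intr L = 1%:M :> 'M[F]_m.
    by rewrite -map_mxM L'L map_mx1.
  split=> [||z /kerAZ/(_ j)/eqP].
  - apply/(kerA _ (intr : {rmorphism int -> F})) => k; rewrite -row_mul L'LF !mxE.
    have [<-|_] := eqVneq j k; last exact: mul0r.
    by rewrite [X in _ * X](eqP dj0) mulr0.
  - rewrite -row_mul map_col colE mulmxA L'LF mul1mx; apply/eqP => /matrixP/(_ 0 0)/eqP.
    by rewrite !mxE eqxx oner_eq0.
  - rewrite mulf_eq0 (negPf dj) orbF => /eqP zL.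
    by apply/matrixP=> a b; rewrite !ord1 colE mulmxA -colE mxE zL mxE.
(* In the coordinates given by [L], [E] is the projection onto the indices with zero elementary
   divisor. *)
pose dE := \row_j ((d j == 0)%:R : int).
pose E := L *m diag_mx dE *m L'; exists E.
(* A general domain covers both the integers and [F]: when [f] kills no nonzero [d j], the kernel
   over [S] consists of the vectors supported, after [L], where [d j = 0]. *)
have idE (S : idomainType) (f : {rmorphism int -> S}) (y : 'rV[S]_m) :
    (forall j, f (d j) = 0 -> d j = 0) -> y *m map_mx f A = 0 -> y *m map_mx f E = y.
  move=> f_inj /kerA yLd; rewrite !map_mxM !mulmxA.
  have -> : y *m map_mx f L *m map_mx f (diag_mx dE) = y *m map_mx f L.
    rewrite map_diag_mx mul_mx_diag; apply/matrixP=> i j; rewrite !mxE.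
    have [/eqP d0|dN0] := boolP (d j == 0); first by rewrite rmorph1 mulr1.
    have /eqP := yLd j; rewrite mulf_eq0 => /orP[|/eqP/f_inj/eqP]; last first.
      by rewrite (negPf dN0).
    by rewrite mxE (ord1 i) => /eqP->; rewrite mul0r.
  by rewrite -mulmxA -map_mxM LL' map_mx1 mulmx1.
split.
- apply/row_matrixP=> i; rewrite row_mul row0; apply/kerAZ=> j.
  rewrite -row_mul /E -[_ *m L]mulmxA L'L mulmx1 mul_mx_diag !mxE.
  by have [->|] := eqVneq (d j) 0; rewrite ?mulr0 ?mul0r.
- move=> y; have := idE _ (idfun : {rmorphism int -> int}) y.
  by rewrite !map_int_id; apply.
- move=> y; apply: (idE _ (intr : {rmorphism int -> F})) => j /eqP dj0; apply/eqP.
  by have := odd_d j; rewrite dj0 andbT negbK.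
Qed.

(** * Embedding the ring into a product of the integers and fields with two elements *)

Definition zz_int (x : ZplusZ2) : int := x.1.

(** Adding the integer part to [x.2 i] makes the coordinate multiplicative. The target is ['F_2], so
    that linear algebra over a field applies. *)
Definition zz_coord (i : nat) (x : ZplusZ2) : 'F_2 := x.1%:~R + x.2 i.

Definition ds_coord (i : nat) (a : dsumZ2) : 'F_2 := a i.

Fact ds_coord_is_zmod_morphism i : zmod_morphism (ds_coord i).
Proof. by move=> a b; rewrite /ds_coord ds_addE ds_oppE. Qed.

HB.instance Definition _ i :=
  GRing.isZmodMorphism.Build dsumZ2 'F_2 (ds_coord i) (ds_coord_is_zmod_morphism i).

Fact zz_int_is_zmod_morphism : zmod_morphism zz_int.
Proof. by []. Qed.

Fact zz_int_is_monoid_morphism : monoid_morphism zz_int.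
Proof. by []. Qed.

HB.instance Definition _ :=
  GRing.isZmodMorphism.Build ZplusZ2 int zz_int zz_int_is_zmod_morphism.
HB.instance Definition _ :=
  GRing.isMonoidMorphism.Build ZplusZ2 int zz_int zz_int_is_monoid_morphism.

Lemma zz_coordE i x : zz_coord i x = (zz_int x)%:~R + ds_coord i x.2.
Proof. by []. Qed.

(** The product rule of [zz_mul], read in [S], factors; this gives the multiplicativity of
    [zz_coord]. *)
Lemma mul_intrD (S : comNzRingType) (p q : int) (u v : S) :
  p%:~R * q%:~R + (v *~ p + u *~ q + u * v) = (p%:~R + u) * (q%:~R + v).
Proof. by rewrite -(mulrzr v) -(mulrzr u) mulrDl !mulrDr !addrA (mulrC v). Qed.

Fact zz_coord_is_zmod_morphism i : zmod_morphism (zz_coord i).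
Proof.
move=> x y; rewrite !zz_coordE (raddfB zz_int) intrB (raddfB (ds_coord i)).
by rewrite opprD addrACA.
Qed.

Fact zz_coord_is_monoid_morphism i : monoid_morphism (zz_coord i).
Proof.
split=> [|x y]; first by rewrite zz_coordE raddf0 addr0.
have -> : zz_coord i (x * y) = (zz_int x)%:~R * (zz_int y)%:~R +
    (ds_coord i y.2 *~ x.1 + ds_coord i x.2 *~ y.1 + ds_coord i x.2 * ds_coord i y.2).
  rewrite zz_coordE (rmorphM zz_int) intrM !(raddfD (ds_coord i)).
  congr (_ + (_ + _ + _)); [exact: raddfMz | exact: raddfMz | exact: ds_mulE].
exact: mul_intrD.
Qed.

HB.instance Definition _ i :=
  GRing.isZmodMorphism.Build ZplusZ2 'F_2 (zz_coord i) (zz_coord_is_zmod_morphism i).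
HB.instance Definition _ i :=
  GRing.isMonoidMorphism.Build ZplusZ2 'F_2 (zz_coord i) (zz_coord_is_monoid_morphism i).

(** Injectivity of the embedding: once the integer parts agree, the shift cancels in each
    coordinate. *)
Lemma zz_eqP x y :
  zz_int x = zz_int y -> (forall i, zz_coord i x = zz_coord i y) -> x = y.
Proof.
case: x y => [m a] [n b]; rewrite /zz_int /= => -> ab; congr (_, _).
by apply/fsfunP=> i; have := ab i; rewrite /zz_coord /= => /addrI.
Qed.

Lemma zz_mx_eqP m n (A B : 'M[ZplusZ2]_(m, n)) :
    map_mx zz_int A = map_mx zz_int B ->
    (forall i, map_mx (zz_coord i) A = map_mx (zz_coord i) B) ->
  A = B.
Proof.
move=> /matrixP int_eq coord_eq; apply/matrixP=> p q; apply: zz_eqP.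
  by have := int_eq p q; rewrite !mxE.
by move=> i; have /matrixP/(_ p q) := coord_eq i; rewrite !mxE.
Qed.

(** The correction [t i - m] on the indices below [N] has finite support, so it defines an element
    of the direct sum. *)
Lemma zz_glue N (m : int) (t : nat -> 'F_2) : exists x, zz_int x = m /\
  forall i, zz_coord i x = if (i < N)%N then t i else m%:~R.
Proof.
pose a : dsumZ2 := [fsfun i in [fset i in iota 0 N]%fset => t i - m%:~R : 'Z_2].
exists (m, a); split=> // i; rewrite /zz_coord fsfunE !inE mem_iota /=.
by case: ifP => _; rewrite ?addr0 // addrC subrK.
Qed.

Lemma zz_glue_mx N m n (Z : 'M[int]_(m, n)) (T : nat -> 'M['F_2]_(m, n)) :
  exists A, map_mx zz_int A = Z /\
    forall i, map_mx (zz_coord i) A = if (i < N)%N then T i else map_mx intr Z.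
Proof.
have /fin_all_exists[x Hx] (pq : 'I_m * 'I_n) :=
  zz_glue N (Z pq.1 pq.2) (fun i => T i pq.1 pq.2).
exists (\matrix_(p, q) x (p, q)); split=> [|i]; apply/matrixP=> p q; rewrite !mxE.
  by have [-> _] := Hx (p, q).
by have [_ ->] := Hx (p, q); case: ifP; rewrite ?mxE.
Qed.

Lemma zz_coord_eventually x :
  exists N, forall i, (N <= i)%N -> zz_coord i x = (zz_int x)%:~R.
Proof.
exists (\max_(j <- finsupp x.2) j.+1)%N => i lei.
rewrite zz_coordE /ds_coord fsfun_dflt ?addr0 //.
apply: contraL lei => ix; rewrite -ltnNge.
exact: (@leq_bigmax_seq _ _ predT succn i ix isT).
Qed.

Lemma zz_coord_mx_eventually m n (A : 'M[ZplusZ2]_(m, n)) :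
  exists N, forall i, (N <= i)%N ->
    map_mx (zz_coord i) A = map_mx intr (map_mx zz_int A).
Proof.
have /fin_all_exists[N HN] (pq : 'I_m * 'I_n) := zz_coord_eventually (A pq.1 pq.2).
exists (\max_pq N pq)%N => i lei; apply/matrixP=> p q; rewrite !mxE.
by apply: (HN (p, q)); apply: leq_trans lei; exact: leq_bigmax.
Qed.

Lemma zz_coord_mxM i m n p (A : 'M[ZplusZ2]_(m, n)) (B : 'M[ZplusZ2]_(n, p)) :
  map_mx (zz_coord i) (A *m B) = map_mx (zz_coord i) A *m map_mx (zz_coord i) B.
Proof. exact: map_mxM. Qed.

(** * Splitting of finitely generated kernels over the ring *)

Lemma zz_split_ker m n k (A : 'M[ZplusZ2]_(m, n)) (B : 'M[ZplusZ2]_(k, m)) :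
    (forall x : 'rV_m, x *m A = 0 <-> exists c, c *m B = x) ->
  exists E : 'M_m, E *m A = 0 /\ forall x : 'rV_m, x *m A = 0 -> x *m E = x.
Proof.
move=> kerA.
have [NA HA] := zz_coord_mx_eventually A; have [NB HB] := zz_coord_mx_eventually B.
case: (smith_ker_reduction (map_mx zz_int A) 'F_2); last first.
  (* At coordinate [N] both [A] and [B] are reductions of their integer parts. The element [x]
     carries [y] at this coordinate and is zero elsewhere. *)
  move=> [w [y [yA yw wA]]]; pose N := maxn NA NB.
  have [x [x0 xE]] :=
    zz_glue_mx N.+1 (0 : 'rV_m) (fun i => if i == N then y else 0).
  have /kerA[c cB] : x *m A = 0.
    apply: zz_mx_eqP => [|i]; first by rewrite map_mxM x0 mul0mx map_mx0.
    rewrite zz_coord_mxM xE !map_mx0 ltnS; case: leqP => _; last by rewrite mul0mx.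
    by case: eqP => [->|_]; rewrite ?mul0mx // HA ?leq_maxl.
  have BA : B *m A = 0.
    apply/row_matrixP=> i; rewrite row_mul row0; apply/kerA.
    by exists (delta_mx 0 i); rewrite rowE.
  (* The integer rows of [B] lie in the kernel of [A], so [w] kills them. At coordinate [N] it then
     kills [x = c *m B], contradicting [yw]. *)
  have Bw : map_mx zz_int B *m w = 0.
    apply/row_matrixP=> i; rewrite row_mul row0; apply: wA.
    by rewrite -row_mul -map_mxM BA map_mx0 row0.
  case/eqP: yw; have := xE N; rewrite ltnSn eqxx => <-.
  rewrite -cB zz_coord_mxM HB ?leq_maxr // -mulmxA -map_mxM Bw.
  by rewrite map_mx0 mulmx0.
move=> [E0 [E0A idE0 idE02]]; pose pinvA i := pinvmx (map_mx (zz_coord i) A).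
(* From [NA] on, [A] is the reduction of its integer part and [E0] serves. Below [NA], the
   generalized inverse satisfies [A *m pinvmx A *m A = A], so [1 - A *m pinvmx A] projects onto the
   kernel. *)
have [E [EZ EF]] := zz_glue_mx NA E0
  (fun i => 1%:M - map_mx (zz_coord i) A *m pinvA i).
exists E; split=> [|x xA].
  apply: zz_mx_eqP => [|i]; first by rewrite map_mxM EZ E0A map_mx0.
  rewrite zz_coord_mxM EF map_mx0; case: ltnP => [_|/HA->].
    by rewrite mulmxBl mul1mx mulmxKpV // subrr.
  by rewrite -map_mxM E0A map_mx0.
apply: zz_mx_eqP => [|i].
  by rewrite map_mxM EZ; apply: idE0; rewrite -map_mxM xA map_mx0.
have xAi : map_mx (zz_coord i) x *m map_mx (zz_coord i) A = 0.
  by rewrite -zz_coord_mxM xA map_mx0.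
rewrite zz_coord_mxM EF; case: ltnP => [_|/HA Ai]; last by apply: idE02; rewrite -Ai.
by rewrite mulmxBr mulmx1 mulmxA xAi mul0mx subr0.
Qed.

Theorem proposition39 : coherent ZplusZ2 2.
Proof.
move=> F [P [d [aug [freeP surj ex0 ex1]]]].
apply: (FP2_FP3 freeP surj (ex0 isT) (ex1 0%N isT)).
apply: (fg_ker_split (freeP 0%N isT) (freeP 1%N isT) (freeP 2%N isT) (ex1 0%N isT)).
exact: zz_split_ker.
Qed.
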